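(* Christofides' algorithm is a $3N$-approximation algorithm for the Minimal Cycle Time problem when the connectivity graph $\mathcal G_c$ (with $N$ nodes) is node-capacitated and Euclidean. That is, if $\hat C$ is the directed ring given by the output of Christofides' algorithm (applied as described in the context), then $\tau(\hat C)\le 3N\,\tau^*$, where $\tau^*$ is the minimum cycle time over all (possibly directed) overlays of $\mathcal G_c$.
   Context: Setting. $\mathcal G_c=(\mathcal V,\mathcal E_c)$ is a digraph without self-loops on $N$ nodes. The data are an integer $s\ge 1$, a model size $M>0$, uplink and downlink capacities $C_{\mathrm{UP}}(i),C_{\mathrm{DN}}(i)>0$, computation times $T_c(i)\ge 0$ ($i\in\mathcal V$), and for each $(i,j)\in\mathcal E_c$ a latency $l(i,j)\ge0$ and a core available bandwidth $A(i',j')>0$ (a number attached to the ordered pair $(i,j)$). Overlay and delays. An overlay is a strongly connected spanning subdigraph $\mathcal G_o=(\mathcal V,\mathcal E_o)$ of $\mathcal G_c$. With $\mathcal N_i^-$, $\mathcal N_i^+$ the out- and in-neighbours of $i$ in $\mathcal G_o$, the delays in a node-capacitated network (one where access link delays are not neglected) are $$d_o(i,j)=s\,T_c(i)+l(i,j)+\frac{M}{\min\left(\frac{C_{\mathrm{UP}}(i)}{|\mathcal N_i^-|},\frac{C_{\mathrm{DN}}(j)}{|\mathcal N_j^+|},A(i',j')\right)},\qquad (i,j)\in\mathcal E_o.$$ Cycle time. A circuit is a closed path $\gamma=(i_1,\dots,i_p=i_1)$, $p>1$, along arcs of $\mathcal G_o$; $|\gamma|$ is its number of arcs, $d_o(\gamma)=\sum_{k=1}^{p-1}d_o(i_k,i_{k+1})$,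 and $\tau(\mathcal G_o)=\max_\gamma d_o(\gamma)/|\gamma|$ over all circuits of $\mathcal G_o$. The Minimal Cycle Time problem asks for an overlay of minimal cycle time. Euclidean. $\mathcal G_c$ is called Euclidean if it is complete and its delays $d_c(i,j)=s\,T_c(i)+l(i,j)+\frac{M}{A(i',j')}$ are symmetric, $d_c(i,j)=d_c(j,i)$ for all $i,j\in\mathcal V$, and satisfy the triangle inequality $d_c(i,j)\le d_c(i,k)+d_c(k,j)$ for all $i,j,k\in\mathcal V$. Christofides' algorithm is the classical polynomial-time algorithm for the Travelling Salesman Problem (minimum spanning tree, plus minimum-weight perfect matching on its odd-degree vertices, Eulerian circuit, shortcutting to a Hamiltonian cycle), a $\tfrac32$-approximation algorithm for that problem with metric weights. Here it is used on the graph with the same topology as $\mathcal G_c$ and weights $$d'(i,j)=s\,T_c(i)+l(i,j)+\frac{M}{\min\left(C_{\mathrm{UP}}(i),C_{\mathrm{DN}}(j),A(i',j')\right)},$$ which are the link delays $d_o(i,j)$ when the overlay is a directed ring. The Hamiltonian cycle it returns is used as a directed ring overlay. *)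

(* Defs.v *)
From HB Require Import structures.
From mathcomp Require Import all_boot all_order all_algebra.

Set Implicit Arguments.
Unset Strict Implicit.
Unset Printing Implicit Defensive.

Import Order.TTheory GRing.Theory Num.Theory.
Local Open Scope ring_scope.

(* The latency and the core bandwidth are attached to arcs: their values
   outside the relation [link] are meaningless and carry no hypothesis. *)
Record network (R : realFieldType) (V : finType) := Network {
  link : rel V;
  local_steps : nat;
  model_size : R;
  uplink : V -> R;
  downlink : V -> R;
  comp_time : V -> R;
  latency : V -> V -> R;
  bandwidth : V -> V -> R;
  link_irr : irreflexive link;
  local_steps_gt0 : (0 < local_steps)%N;
  model_size_gt0 : 0 < model_size;
  uplink_gt0 : forall i, 0 < uplink i;
  downlink_gt0 : forall i, 0 < downlink i;
  comp_time_ge0 : forall i, 0 <= comp_time i;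
  latency_ge0 : forall i j, link i j -> 0 <= latency i j;
  bandwidth_gt0 : forall i j, link i j -> 0 < bandwidth i j
}.

Section Delays.
Variables (R : realFieldType) (V : finType) (G : network R V).

Definition core_delay (i j : V) : R :=
  (local_steps G)%:R * comp_time G i + latency G i j
    + model_size G / bandwidth G i j.

Definition euclidean : Prop :=
  [/\ forall i j, i != j -> link G i j,
      forall i j, link G i j -> core_delay i j = core_delay j i
    & forall i j k, link G i j -> link G i k -> link G k j ->
        core_delay i j <= core_delay i k + core_delay k j].

Definition overlay (eo : rel V) : Prop :=
  subrel eo (link G) /\ forall i j, connect eo i j.

Definition outdeg (eo : rel V) (i : V) : nat := #|[set j | eo i j]|.
Definition indeg (eo : rel V) (j : V) : nat := #|[set i | eo i j]|.

(* Only meaningful when [eo i j] holds: both degrees are then positive. *)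
Definition overlay_delay (eo : rel V) (i j : V) : R :=
  (local_steps G)%:R * comp_time G i + latency G i j
    + model_size G /
      Num.min (Num.min (uplink G i / (outdeg eo i)%:R)
                       (downlink G j / (indeg eo j)%:R))
              (bandwidth G i j).

(* The value of [overlay_delay] on the arcs of a directed ring, where both
   degrees are one. *)
Definition ring_delay (i j : V) : R :=
  (local_steps G)%:R * comp_time G i + latency G i j
    + model_size G /
      Num.min (Num.min (uplink G i) (downlink G j)) (bandwidth G i j).

(* The closed path (i_1, ..., i_p = i_1) is encoded by the sequence
   [:: i_1; ...; i_{p-1}], whose size is the number of arcs; repeated
   vertices are allowed. *)
Definition circuit (e : rel V) (c : seq V) : bool := (c != [::]) && cycle e c.

Definition circuit_delay (eo : rel V) (c : seq V) : R :=
  \sum_(a <- zip c (rot 1 c)) overlay_delay eo a.1 a.2.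

Definition circuit_mean (eo : rel V) (c : seq V) : R :=
  circuit_delay eo c / (size c)%:R.

Definition is_cycle_time (eo : rel V) (t : R) : Prop :=
  (exists2 c, circuit eo c & circuit_mean eo c = t)
  /\ (forall c, circuit eo c -> circuit_mean eo c <= t).

Definition is_min_cycle_time (t : R) : Prop :=
  (exists2 eo, overlay eo & is_cycle_time eo t)
  /\ (forall eo t', overlay eo -> is_cycle_time eo t' -> t <= t').

End Delays.

(* Undirected edges are two-element sets of vertices. *)
Section Christofides.
Variables (R : realFieldType) (V : finType).
Variables (e : rel V) (w : {set V} -> R).
Implicit Types (T Mt F : {set {set V}}) (c h : seq V).

Definition edges : {set {set V}} :=
  [set [set a.1; a.2] | a : V * V & e a.1 a.2].

Definition weight F : R := \sum_(a in F) w a.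

Definition adj F : rel V := [rel i j | [set i; j] \in F].

Definition spanning_tree T : Prop :=
  [/\ T \subset edges,
      forall i j, connect (adj T) i j
    & forall c, uniq c -> (2 < size c)%N -> ~~ cycle (adj T) c].

Definition min_spanning_tree T : Prop :=
  spanning_tree T /\ forall T', spanning_tree T' -> weight T <= weight T'.

Definition odd_vertices T : {set V} :=
  [set v | odd #|[set a in T | v \in a]|].

Definition perfect_matching (S : {set V}) Mt : Prop :=
  Mt \subset edges /\ partition Mt S.

Definition min_perfect_matching (S : {set V}) Mt : Prop :=
  perfect_matching S Mt
  /\ forall Mt', perfect_matching S Mt' -> weight Mt <= weight Mt'.

Definition walk_edges c : seq {set V} :=
  [seq [set a.1; a.2] | a <- zip c (rot 1 c)].

(* The closed walk c is an Eulerian circuit of the multigraph T + Mt, in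
   which an edge belonging to both T and Mt has multiplicity two. *)
Definition eulerian T Mt c : Prop := perm_eq (walk_edges c) (enum T ++ enum Mt).

Definition hamiltonian h : Prop := uniq h /\ forall v, v \in h.

(* h is a possible output of Christofides' algorithm, whatever the choices
   made by its steps (ties, Eulerian circuit, occurrences that are skipped) *)
Definition christofides h : Prop :=
  exists T Mt c,
    [/\ min_spanning_tree T,
        min_perfect_matching (odd_vertices T) Mt,
        eulerian T Mt c
      & hamiltonian h /\ subseq h c].

(* Christofides' algorithm needs one weight per undirected edge, whereas arc
   weights d such as [ring_delay] need not be symmetric, even in a Euclidean
   network.  The weight of {i, j} may be any value between d i j and d j i:
   either of them, their minimum, maximum or mean, etc.; it is forced to be
   their common value when they agree. *)
Definition edge_weights_of (d : V -> V -> R) : Prop :=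
  forall i j, e i j ->
    Num.min (d i j) (d j i) <= w [set i; j] <= Num.max (d i j) (d j i).

End Christofides.

Definition directed_ring (V : finType) (h : seq V) : rel V :=
  [rel i j | (i \in h) && (next h i == j)].

(* Main.v *)
Require Import Defs.
From mathcomp Require Import all_boot all_order all_algebra.
From mathcomp Require Import lra.

(* Let K be N times the optimal cycle time, reached by an overlay O.  Every arc
   of O lies on a simple circuit, whose total delay is at most K.  Hence:
   - every access delay M / C_UP(i), M / C_DN(j) is at most K, so that the ring
     delays and the weights w exceed the core delays, which form a metric, by
     at most K;
   - each edge {i, j} underlying O has w{i, j} <= K;
   - every cut is crossed at least twice by some simple circuit, hence crossed
     by an arc of O of delay at most K / 2.
   The arcs of delay at most K / 2 thus contain a spanning tree, of weight at
   most (N - 1) K, and a closed spanning walk with at most 2 (N - 1) arcs and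
   core length at most (N - 1) K.  Shortcutting this walk to the odd vertices
   of the minimum spanning tree T and taking alternate edges yields two perfect
   matchings, so the minimum matching satisfies 2 w(Mt) <= (N - 1) K + N K.
   The core length of the Christofides ring is at most w(T) + w(Mt), so its
   total delay is at most
     (N - 1) K + (N - 1/2) K + N K <= 3 N K. *)

Set Implicit Arguments.
Unset Strict Implicit.
Unset Printing Implicit Defensive.

Import Order.TTheory GRing.Theory Num.Theory.
Local Open Scope ring_scope.

(** * Walks and tours *)

Section Walks.
Variables (R : realFieldType) (V : finType).
Implicit Types (d : V -> V -> R) (e : rel V) (c h p q s : seq V).

Fixpoint walk_length d (x : V) p : R :=
  if p is y :: q then d x y + walk_length d y q else 0.

(** For overlay delays this is convertible to [circuit_delay], so results on walks apply to
    circuits. *)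
Definition tour d c : R := \sum_(a <- zip c (rot 1 c)) d a.1 a.2.

Lemma tour_cons d x p : tour d (x :: p) = walk_length d x (rcons p x).
Proof.
(* The closing vertex is separated from the starting one, which the induction moves. *)
rewrite /tour rot1_cons; set y := {2 4}x; move: y => y.
elim: p x => [|z p IHp] x; first by rewrite /= big_seq1 addr0.
by rewrite /= big_cons IHp.
Qed.

Lemma walk_length_cat d x p q :
  walk_length d x (p ++ q) = walk_length d x p + walk_length d (last x p) q.
Proof. by elim: p x => [|y p IHp] x /=; rewrite ?add0r // IHp addrA. Qed.

Lemma walk_length_rcons d x p y :
  walk_length d x (rcons p y) = walk_length d x p + d (last x p) y.
Proof. by rewrite -cats1 walk_length_cat /= addr0. Qed.

Lemma walk_length_ge0 d e x p :
  (forall i j, e i j -> 0 <= d i j) -> path e x p -> 0 <= walk_length d x p.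
Proof.
move=> d_ge0; elim: p x => [|y p IHp] x //= /andP[exy py].
by rewrite addr_ge0 ?d_ge0 ?IHp.
Qed.

Lemma walk_length_le d e (B : R) x p :
  (forall i j, e i j -> d i j <= B) -> path e x p ->
  walk_length d x p <= B * (size p)%:R.
Proof.
move=> d_le; elim: p x => [|y p IHp] x /=; first by rewrite mulr0.
by case/andP=> exy py; rewrite -natr1 mulrDr mulr1 addrC lerD ?d_le ?IHp.
Qed.

Lemma zip_next s : uniq s -> zip s (rot 1 s) = [seq (x, next s x) | x <- s].
Proof.
case: s => [//|x p] Us; apply: (@eq_from_nth _ (x, x)).
  by rewrite size_zip size_rot minnn size_map.
move=> i; rewrite size_zip size_rot minnn => lti.
rewrite nth_zip ?size_rot // (nth_map x) // next_nth mem_nth // index_uniq //.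
(* At the last index [next] reads the default of [nth], the first vertex: this is the
   wrap-around. *)
by congr (_, _); rewrite rot1_cons nth_rcons if_same; case: ltnP => // /(nth_default x)->.
Qed.

Lemma next_neq s x : uniq s -> (1 < size s)%N -> x \in s -> next s x != x.
Proof.
move=> Us s_gt1 xs; have [i s' def_s] := rot_to xs.
rewrite -(next_rot i) // def_s; move: s_gt1 Us.
rewrite -(size_rot i) -(rot_uniq i) def_s.
case: s' {def_s} => [//|y s'] _ /=; rewrite eqxx inE negb_or => /andP[/andP[nxy _] _].
by rewrite eq_sym.
Qed.

Lemma tour_next d s : uniq s -> tour d s = \sum_(x <- s) d x (next s x).
Proof. by move=> Us; rewrite /tour zip_next // big_map. Qed.

(** * Shortcuts under the triangle inequality *)

Section Shortcuts.
Variable d : V -> V -> R.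
Hypothesis d_self : forall i, d i i = 0.
Hypothesis d_triangle : forall i j k, d i j <= d i k + d k j.

Lemma walk_length_subseq x p q y :
  subseq q p -> walk_length d x (rcons q y) <= walk_length d x (rcons p y).
Proof.
have head_shift a b s :
    walk_length d a (rcons s y) <= d a b + walk_length d b (rcons s y).
  by case: s => [|z s] /=; rewrite ?addr0 // addrA lerD2r.
elim: p x q => [|b p IHp] x q; first by rewrite subseq0 => /eqP->.
case: q => [|a q] /=.
  move=> _; rewrite addr0; apply: le_trans (d_triangle x y b) _.
  by rewrite lerD2l; have:= IHp b [::] (sub0seq _); rewrite /= addr0.
case: eqP => [<- sqp|_ sqp]; first by rewrite lerD2l IHp.
apply: le_trans (head_shift x b (a :: q)) _.
by rewrite lerD2l; apply: IHp.
Qed.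

Lemma tour_subseq h c : subseq h c -> tour d h <= tour d c.
Proof.
case: c => [|b p]; first by rewrite subseq0 => /eqP->.
(* Skipping all vertices but [b] leaves a loop of length zero. *)
have tour_ge0 : 0 <= tour d (b :: p).
  rewrite tour_cons; apply: le_trans (walk_length_subseq b b (sub0seq p)).
  by rewrite /= d_self addr0.
case: h => [|a s]; first by rewrite {1}/tour big_nil.
rewrite !tour_cons /=; case: eqP => [-> sp|_ sp]; first exact: walk_length_subseq.
(* Here the base [b] is skipped too: the closed walk at [b] is first cut down to [a :: s], then its
   arcs into and out of [b] are merged into one. *)
apply: le_trans (walk_length_subseq b b sp).
rewrite /= !walk_length_rcons addrCA lerD2l.
by rewrite [X in _ <= X]addrC.
Qed.

End Shortcuts.
End Walks.

(** * Spanning trees, spanning walks and perfect matchings *)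

Section SpanningStructures.
Variable V : finType.
Implicit Types (X : {set V}) (F : {set {set V}}).

Lemma set2_injr (x y z : V) : [set x; y] = [set x; z] -> y = z.
Proof.
move=> exy; have /set2P[yx|//] : y \in [set x; z] by rewrite -exy set22.
by have := set22 x z; rewrite -exy yx setUid => /set1P.
Qed.

Lemma adj_sym F : symmetric (adj F).
Proof. by move=> x y; rewrite /adj /= setUC. Qed.

Variable g : rel V.
Hypothesis g_sym : symmetric g.
Hypothesis g_crossing : forall X, X != set0 -> X != setT ->
  exists x y, [/\ x \in X, y \notin X & g x y].

(** Growth as in Prim's algorithm: every proper nonempty set has an outgoing edge, so adding heads
    of such edges one at a time exhausts [V]. *)
Lemma grow_setT (P : {set V} -> Prop) r :
  P [set r] ->
  (forall X x y, P X -> x \in X -> y \notin X -> g x y -> P (y |: X)) ->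
  P setT.
Proof.
move=> P1 Pgrow.
suff grow n : (0 < n <= #|V|)%N -> exists X, [/\ P X, X != set0 & #|X| = n].
  have V_gt0 : (0 < #|V|)%N by apply/card_gt0P; exists r.
  have [|X [PX _ cardX]] := grow #|V|; first by rewrite V_gt0 /=.
  by have <-: X = setT by apply/eqP; rewrite eqEcard subsetT cardsT cardX /=.
elim: n => [//|[_ _|n IHn]] /=.
  by exists [set r]; split; rewrite ?cards1 // -card_gt0 cards1.
move=> ltnV; have [|X [PX X_neq0 cardX]] := IHn; first exact: ltnW.
have XnT: X != setT.
  by apply: contraTneq ltnV => XT; rewrite -leqNgt -cardsT -XT cardX.
have [x [y [xX yX gxy]]] := g_crossing X_neq0 XnT.
exists (y |: X); split; first exact: Pgrow gxy.
  by apply/set0Pn; exists y; rewrite setU11.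
by rewrite cardsU1 yX cardX.
Qed.

(** Each new vertex [y] is reached by a detour [x, y, x] inserted at a visit of [x]. This costs two
    arcs per vertex other than [r]. *)
Lemma closed_spanning_walk (r : V) : exists p,
  [/\ path g r p, last r p = r, (size p + 2 <= 2 * #|V|)%N
    & forall x, x \in r :: p].
Proof.
pose P X := exists p, [/\ path g r p, last r p = r,
  (size p + 2 <= 2 * #|X|)%N & {subset X <= r :: p}].
suff [p [gp lp szp sp]]: P setT.
  by exists p; split; rewrite -?cardsT // => x; apply: sp.
apply: (@grow_setT _ r) => [|X x y [p [gp lp szp sp]] xX yX gxy].
  by exists [::]; split; rewrite ?cards1 // => x /set1P->; rewrite mem_head.
case: (splitPl (sp x xX)) (sp) gp lp szp => p1 p2 lp1 {}sp gp lp szp.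
exists (p1 ++ y :: x :: p2); split.
- by move: gp; rewrite !cat_path /= lp1 gxy g_sym gxy.
- by move: lp; rewrite !last_cat /= lp1.
- by move: szp; rewrite cardsU1 yX !size_cat /= mulnDr muln1 !addnS !addn0 add2n !ltnS.
- move=> z /setU1P[->|/sp]; first by rewrite inE mem_cat mem_head !orbT.
  by rewrite !(inE, mem_cat) => /or3P[]->; rewrite ?orbT.
Qed.

(** The only neighbour of [y] is [x], whereas a vertex on a cycle of length at least three has two
    distinct neighbours. *)
Lemma acyclic_add_leaf F (x y : V) :
  {in F, forall a : {set V}, y \notin a} ->
  (forall c, uniq c -> (2 < size c)%N -> ~~ cycle (adj F) c) ->
  forall c, uniq c -> (2 < size c)%N -> ~~ cycle (adj ([set x; y] |: F)) c.
Proof.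
move=> yF acF c Uc c_gt2; apply/negP => cyc.
have adj_y z : adj ([set x; y] |: F) y z -> z = x.
  rewrite /adj /= in_setU1 => /orP[/eqP|/yF]; last by rewrite set21.
  by rewrite [RHS]setUC => /set2_injr.
have [yc|yc] := boolP (y \in c); last first.
  case/negP: (acF c Uc c_gt2); apply: (sub_in_cycle _ _ cyc); last first.
    by apply/allP => z zc; exact: zc.
  move=> a b ac bc; rewrite /adj /= in_setU1 => /orP[/eqP eab|//].
  by have:= set22 x y; rewrite -eab !inE => /orP[] /eqP y_eq; rewrite y_eq ?ac ?bc in yc.
have [i s def_c] := rot_to yc.
move: Uc c_gt2 cyc; rewrite -(rot_uniq i) -(size_rot i) -(rot_cycle i) def_c.
case: s {def_c} => [//|a s] /= /and3P[_ a_s _] s_gt0 /andP[/adj_y ax].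
rewrite rcons_path adj_sym => /andP[_ /adj_y lx].
by case: s lx a_s s_gt0 => //= b s lx; rewrite ax -lx mem_last.
Qed.

(** Every growth step attaches a leaf through an edge of [g], which preserves connectedness and
    acyclicity and adds at most one edge per vertex. *)
Lemma spanning_tree_in (e : rel V) (r : V) : subrel g e -> exists T,
  [/\ spanning_tree e T, (#|T| < #|V|)%N
    & forall a, a \in T -> exists x y, g x y /\ a = [set x; y]].
Proof.
move=> sub_ge.
pose P X := exists F, [/\ (#|F| < #|X|)%N,
  forall a, a \in F -> exists x y, [/\ g x y, a = [set x; y], x \in X & y \in X],
  {in X &, forall i j, connect (adj F) i j}
  & forall c, uniq c -> (2 < size c)%N -> ~~ cycle (adj F) c].
suff [F [cardF Fg conF acF]]: P setT.
  exists F; split; last by move=> a /Fg[x [y [gxy -> _ _]]]; exists x, y.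
    split=> [|i j|//]; last by apply: conF; rewrite inE.
    apply/subsetP => a /Fg[x [y [/sub_ge exy -> _ _]]].
    by apply/imsetP; exists (x, y); rewrite ?inE.
  by rewrite -cardsT.
apply: (@grow_setT _ r) => [|X x y [F [cardF Fg conF acF]] xX yX gxy].
  exists set0; split.
  - by rewrite cards0 cards1.
  - by move=> a; rewrite inE.
  - by move=> i j /set1P-> /set1P->.
  - case=> [//|a [//|b s]] _ _; by rewrite /adj /= inE.
have yF : {in F, forall a : {set V}, y \notin a}.
  move=> a /Fg[i [j [_ -> iX jX]]]; apply: contra yX.
  by rewrite !inE => /orP[]/eqP->.
have sub_adj : subrel (adj F) (adj ([set x; y] |: F)).
  by rewrite /adj => i j /= ijF; rewrite in_setU1 ijF orbT.
have conX : {in X &, forall i j, connect (adj ([set x; y] |: F)) i j}.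
  move=> i j iX jX; apply: connect_sub (conF i j iX jX) => a b /sub_adj.
  exact: connect1.
have conxy i : i \in y |: X -> connect (adj ([set x; y] |: F)) x i.
  case/setU1P => [->|]; last exact: conX.
  by apply: connect1; rewrite /adj /= setU11.
exists ([set x; y] |: F); split.
- rewrite !cardsU1 yX; apply: leq_ltn_trans (leq_add (leq_b1 _) (leqnn _)) _.
  by rewrite ltn_add2l.
- move=> a /setU1P[->|/Fg[i [j [gij -> iX jX]]]].
    by exists x, y; split; rewrite ?setU11 ?setU1r.
  by exists i, j; split; rewrite ?setU1r.
- move=> i j /conxy xi /conxy xj.
  by apply: connect_trans xj; rewrite (sym_connect_sym (@adj_sym _)).
- exact: acyclic_add_leaf.
Qed.

End SpanningStructures.

(** * Alternate matchings of an even cycle *)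

Section Pairs.
Variable V : finType.
Implicit Types (s p : seq V).

(** On a cycle [s] of even length, [pairs s] and [pairs (rot 1 s)] are the two matchings made of
    alternate edges. *)
Fixpoint pairs s : seq {set V} :=
  if s is x :: y :: s' then [set x; y] :: pairs s' else [::].

Lemma pairs_partition s : uniq s -> ~~ odd (size s) ->
  uniq (pairs s) /\ partition [set a in pairs s] [set x in s].
Proof.
elim: {s}(size s).+1 {-2}s (ltnSn (size s)) => // n IHn [|x [|y s]] //=.
  move=> _ _ _; split=> //; rewrite /partition; apply/and3P; split.
  - by apply/eqP/setP=> z; rewrite !inE; apply/bigcupP => -[a]; rewrite inE.
  - by apply/trivIsetP => a b; rewrite inE.
  - by rewrite inE.
rewrite !ltnS !inE !negb_or negbK => /ltnW lt_sn /and3P[/andP[nxy xs] ys Us] evens.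
have [Up part_s] := IHn s lt_sn Us evens.
have disj : [disjoint [set x; y] & [set z in s]].
  rewrite disjoint_subset; apply/subsetP => z.
  by rewrite !inE => /orP[]/eqP->.
have notin : [set x; y] \notin pairs s.
  apply: contra xs => xy_s; have := cover_partition part_s.
  move/setP/(_ x); rewrite inE => <-; apply/bigcupP.
  by exists [set x; y]; rewrite ?inE ?eqxx.
split; first by rewrite notin.
have -> : [set a in [set x; y] :: pairs s] = [set x; y] |: [set a in pairs s].
  by apply/setP => a; rewrite !inE.
have -> : [set z in [:: x, y & s]] = [set x; y] :|: [set z in s].
  by apply/setP => z; rewrite !inE orbA.
apply: partitionU1 => //; by apply/set0Pn; exists x; rewrite set21.
Qed.

Lemma pairsP s a : uniq s -> a \in pairs s -> exists x y, x != y /\ a = [set x; y].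
Proof.
elim: {s}(size s).+1 {-2}s (ltnSn (size s)) => // n IHn [|x [|y s]] //=.
rewrite !ltnS !inE !negb_or => /ltnW lt_sn /and3P[/andP[nxy _] _ Us].
by case/orP=> [/eqP->|/(IHn s lt_sn Us)//]; exists x, y.
Qed.

Lemma sum_pairs_rot (R : realFieldType) (w : {set V} -> R) s : ~~ odd (size s) ->
  \sum_(a <- pairs s) w a + \sum_(a <- pairs (rot 1 s)) w a =
  \sum_(a <- walk_edges s) w a.
Proof.
case: s => [|x p]; first by rewrite !big_nil addr0.
(* The closing vertex becomes an arbitrary [y], so that two edges can be peeled off at a time. *)
rewrite /walk_edges rot1_cons; move: {3 5}x => y.
elim: {p}(size p).+1 x {-2}p (ltnSn (size p)) => // n IHn x [|b [|c q]] //.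
  by move=> _ _; rewrite /= !big_cons !big_nil !addr0.
rewrite !ltnS => /ltnW lt_qn; rewrite /= negbK => oddq.
have /= := IHn c q lt_qn oddq; rewrite !big_cons /=; lra.
Qed.

End Pairs.

(** * Delays in an overlay *)

Section Delays.
Variables (R : realFieldType) (V : finType) (G : network R V).
Implicit Types (eo : rel V) (i j : V).

Let up i := model_size G / uplink G i.
Let dn i := model_size G / downlink G i.

Lemma div_model_size_le x y :
  0 < y -> y <= x -> model_size G / x <= model_size G / y.
Proof.
move=> y_gt0 le_yx; rewrite ler_pM2l ?model_size_gt0 //.
by rewrite lef_pV2 ?posrE // (lt_le_trans y_gt0).
Qed.

Lemma div_model_size_ge0 x : 0 < x -> 0 <= model_size G / x.
Proof. by move=> x_gt0; rewrite divr_ge0 ?ltW ?model_size_gt0. Qed.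

Lemma fixed_delay_ge0 i j : link G i j ->
  0 <= (local_steps G)%:R * comp_time G i + latency G i j.
Proof.
by move=> Lij; rewrite addr_ge0 ?latency_ge0 // mulr_ge0 ?comp_time_ge0.
Qed.

Lemma ring_capacity_gt0 i j : link G i j ->
  0 < Num.min (Num.min (uplink G i) (downlink G j)) (bandwidth G i j).
Proof. by move=> Lij; rewrite !lt_min uplink_gt0 downlink_gt0 bandwidth_gt0. Qed.

Lemma core_delay_ge0 i j : link G i j -> 0 <= core_delay G i j.
Proof.
move=> Lij.
by rewrite addr_ge0 ?fixed_delay_ge0 // div_model_size_ge0 ?bandwidth_gt0.
Qed.

Lemma core_delay_le_ring i j : link G i j -> core_delay G i j <= ring_delay G i j.
Proof.
move=> Lij; rewrite lerD2l div_model_size_le ?ring_capacity_gt0 //.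
by rewrite ge_min lexx orbT.
Qed.

Lemma up_le_ring i j : link G i j -> up i <= ring_delay G i j.
Proof.
move=> Lij; rewrite -[leLHS]add0r lerD ?fixed_delay_ge0 //.
by rewrite div_model_size_le ?ring_capacity_gt0 // !ge_min lexx.
Qed.

Lemma dn_le_ring i j : link G i j -> dn j <= ring_delay G i j.
Proof.
move=> Lij; rewrite -[leLHS]add0r lerD ?fixed_delay_ge0 //.
by rewrite div_model_size_le ?ring_capacity_gt0 // !ge_min lexx orbT.
Qed.

(** The minimum is one of the three capacities: the core bandwidth gives back the core delay, and an
    access capacity contributes at most [B]. *)
Lemma ring_delay_le_core (B : R) i j : link G i j ->
  up i <= B -> dn j <= B -> ring_delay G i j <= core_delay G i j + B.
Proof.
move=> Lij le_up le_dn; rewrite /core_delay -addrA lerD2l.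
have up_ge0 : 0 <= up i by rewrite div_model_size_ge0 ?uplink_gt0.
have bw_ge0 := div_model_size_ge0 (bandwidth_gt0 Lij).
rewrite /up /dn in le_up le_dn up_ge0.
rewrite {1}/Num.min; case: ifP => _; last by rewrite lerDl (le_trans up_ge0).
by rewrite /Num.min; case: ifP => _; rewrite ler_wpDl.
Qed.

Lemma outdeg_gt0 eo i j : eo i j -> (0 < outdeg eo i)%N.
Proof. by move=> ij; apply/card_gt0P; exists j; rewrite inE. Qed.

Lemma indeg_gt0 eo i j : eo i j -> (0 < indeg eo j)%N.
Proof. by move=> ij; apply/card_gt0P; exists i; rewrite inE. Qed.

Section Overlay.
Variable eo : rel V.
Hypothesis eo_overlay : overlay G eo.

Let D := overlay_delay G eo.

Let eo_link i j : eo i j -> link G i j.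
Proof. by case: eo_overlay => sub_eo _; apply: sub_eo. Qed.

(** Both degrees are at least one on an arc of the overlay, so sharing can only lower a capacity. *)
Lemma ring_delay_le_overlay i j : eo i j -> ring_delay G i j <= D i j.
Proof.
move=> ij; have Lij := eo_link ij.
have o_gt0 := outdeg_gt0 ij; have i_gt0 := indeg_gt0 ij.
have divn_le (x : R) n : 0 < x -> (0 < n)%N -> x / n%:R <= x.
  by move=> x_gt0 n_gt0; rewrite ler_pdivrMr ?ltr0n // ler_peMr ?ler1n // ltW.
rewrite lerD2l div_model_size_le //.
  by rewrite !lt_min !divr_gt0 ?ltr0n ?uplink_gt0 ?downlink_gt0 ?bandwidth_gt0.
by rewrite !le_min !ge_min !divn_le ?uplink_gt0 ?downlink_gt0 // lexx !orbT.
Qed.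

Lemma overlay_delay_ge0 i j : eo i j -> 0 <= D i j.
Proof.
move=> ij; apply: le_trans (ring_delay_le_overlay ij).
have Lij := eo_link ij.
exact: le_trans (core_delay_ge0 Lij) (core_delay_le_ring Lij).
Qed.

Lemma circuit_delay_ge0 c : circuit eo c -> 0 <= circuit_delay G eo c.
Proof.
case: c => // x p cyc; rewrite -[leRHS]/(tour D (x :: p)) tour_cons.
exact: (walk_length_ge0 overlay_delay_ge0 cyc).
Qed.

(** The first arc leaving [X] is one term of a sum of nonnegative delays. *)
Lemma path_crossing (X : {set V}) x p : path eo x p -> x \in X ->
  last x p \notin X ->
  exists a b, [/\ a \in X, b \notin X, eo a b & D a b <= walk_length D x p].
Proof.
elim: p x => [|y p IHp] x /=; first by move=> _ ->.
case/andP=> xy py xX lX; have Dxy := overlay_delay_ge0 xy.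
have [yX|yX] := boolP (y \in X); last first.
  by exists x, y; rewrite lerDl (walk_length_ge0 overlay_delay_ge0 py).
have [a [b [aX bX ab le_ab]]] := IHp y py yX lX.
by exists a, b; split; rewrite // (le_trans le_ab) // lerDr.
Qed.

Lemma overlay_crossing (X : {set V}) : X != set0 -> X != setT ->
  exists i j, [/\ i \in X, j \notin X & eo i j].
Proof.
case/set0Pn=> x xX; rewrite -subTset => /subsetPn[y _ yX].
case: eo_overlay => _ /(_ x y)/connectP[p px y_last].
rewrite y_last in yX; have [a [b [aX bX ab _]]] := path_crossing px xX yX.
by exists a, b.
Qed.

Hypothesis V_gt1 : (1 < #|V|)%N.

Lemma overlay_succ i : exists2 j, j != i & eo i j.
Proof.
have [||a [b []]] := @overlay_crossing [set i].
- by apply/set0Pn; exists i; rewrite set11.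
- by apply: contraTneq V_gt1 => e1; rewrite -cardsT -e1 cards1.
by move=> /set1P-> + ab; rewrite inE => nb; exists b.
Qed.

Lemma overlay_pred j : exists2 i, i != j & eo i j.
Proof.
have [||a [b []]] := @overlay_crossing [set~ j].
- by rewrite -card_gt0 cardsC1 -subn1 subn_gt0.
- by apply/eqP/setP => /(_ j); rewrite !inE eqxx.
by rewrite !inE negbK => nab /eqP-> ab; exists a.
Qed.

(** * Consequences of a bound on all circuit means *)

Section CycleBound.
Variable t : R.
Hypothesis mean_le : forall c, circuit eo c -> circuit_mean G eo c <= t.

Let K : R := #|V|%:R * t.

(** A simple path from [j] back to [i] closes with the arc [(i, j)] into a circuit of at most [#|V|]
    arcs, of mean at most [t]. *)
Lemma return_walk i j : eo i j ->
  exists p, [/\ path eo j p, last j p = i & walk_length D j p + D i j <= K].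
Proof.
move=> ij; case: eo_overlay => _ /(_ j i)/connectP[p0 /shortenP[p jp Up _] p_last].
exists p; split=> //.
have cyc : circuit eo (j :: p) by rewrite /circuit /= rcons_path jp -p_last.
have := mean_le cyc; rewrite /circuit_mean ler_pdivrMr ?ltr0n //.
(* The sign of [t] is what allows the number of arcs to be replaced by [#|V|]. *)
have t_ge0 : 0 <= t.
  by apply: le_trans (mean_le cyc); rewrite divr_ge0 ?circuit_delay_ge0.
rewrite -[circuit_delay _ _ _]/(tour D (j :: p)) tour_cons.
rewrite walk_length_rcons -p_last => /le_trans-> //.
by rewrite mulrC ler_wpM2r // ler_nat -(card_uniqP Up) max_card.
Qed.

Lemma overlay_delay_le i j : eo i j -> D i j <= K.
Proof.
move=> ij; have [p [jp _ leK]] := return_walk ij.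
by apply: le_trans leK; rewrite lerDr (walk_length_ge0 overlay_delay_ge0 jp).
Qed.

Lemma up_le_cycle i : up i <= K.
Proof.
have [j _ ij] := overlay_succ i; apply: le_trans (overlay_delay_le ij).
exact: le_trans (up_le_ring (eo_link ij)) (ring_delay_le_overlay ij).
Qed.

Lemma dn_le_cycle j : dn j <= K.
Proof.
have [i _ ij] := overlay_pred j; apply: le_trans (overlay_delay_le ij).
exact: le_trans (dn_le_ring (eo_link ij)) (ring_delay_le_overlay ij).
Qed.

(* The walk from j back to i leaves j and enters i, so its length dominates
   the access delays that the reverse arc (j, i) would suffer. *)
Lemma reverse_ring_delay_le i j : link G j i ->
  core_delay G j i = core_delay G i j -> eo i j -> ring_delay G j i <= K.
Proof.
move=> Lji sym_c ij; have [p [jp p_last leK]] := return_walk ij.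
apply: le_trans leK; rewrite addrC.
apply: (@le_trans _ _ (core_delay G j i + walk_length D j p)); last first.
  rewrite lerD2r sym_c; apply: le_trans (ring_delay_le_overlay ij).
  by rewrite core_delay_le_ring ?eo_link.
have nij : j != i by apply: contraTneq Lji => ->; rewrite link_irr.
apply: ring_delay_le_core => //.
  case: p jp p_last => [_ ji|y p /= /andP[jy py] _].
    by rewrite /= in ji; rewrite ji eqxx in nij.
  rewrite ler_wpDr ?(walk_length_ge0 overlay_delay_ge0 py) //.
  exact: le_trans (up_le_ring (eo_link jy)) (ring_delay_le_overlay jy).
case/lastP: p jp p_last => [_ ji|p y].
  by rewrite /= in ji; rewrite ji eqxx in nij.
rewrite rcons_path last_rcons walk_length_rcons => /andP[jp py] yi.
rewrite yi in py *.
rewrite ler_wpDl ?(walk_length_ge0 overlay_delay_ge0 jp) //.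
exact: le_trans (dn_le_ring (eo_link py)) (ring_delay_le_overlay py).
Qed.

(** Symmetrised because spanning trees and walks along them traverse overlay arcs in both
    directions. *)
Definition cheap : rel V :=
  [rel i j | eo i j && (D i j <= K / 2) || eo j i && (D j i <= K / 2)].

Lemma cheap_sym : symmetric cheap.
Proof. by move=> i j; rewrite /cheap /= orbC. Qed.

(* A simple circuit through an arc leaving X also contains an arc entering X;
   the cheaper of the two costs at most half of the circuit. *)
Lemma cheap_crossing (X : {set V}) : X != set0 -> X != setT ->
  exists i j, [/\ i \in X, j \notin X & cheap i j].
Proof.
move=> X0 XT; have [i [j [iX jX ij]]] := overlay_crossing X0 XT.
have [p [jp p_last leK]] := return_walk ij.
have [||a [b [aX bX ab le_ab]]] := @path_crossing (~: X) j p jp.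
- by rewrite inE.
- by rewrite p_last inE negbK.
rewrite !inE negbK in aX bX.
have [le_ij|lt_ij] := lerP (D i j) (K / 2).
  by exists i, j; rewrite /cheap /= ij le_ij.
exists b, a; split=> //; rewrite /cheap /= ab; apply/orP; right.
rewrite /=; lra.
Qed.

End CycleBound.
End Overlay.
End Delays.

(** * Existence of cycle times and the directed ring *)

Section CycleTimeExists.
Variables (R : realFieldType) (V : finType).
Implicit Types (d : V -> V -> R) (eo : rel V) (c p q : seq V).

(** The value is a functional relation because a cycle time is specified by a property rather than
    computed. *)
Lemma seq_min_value (T : eqType) (Q : T -> R -> Prop) (s : seq T) :
  s != [::] -> (forall x, x \in s -> exists t, Q x t) ->
  (forall x t t', Q x t -> Q x t' -> t = t') ->
  exists x t, [/\ x \in s, Q x t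
    & forall y t', y \in s -> Q y t' -> t <= t'].
Proof.
move=> + + Qfun; elim: s => // x s IHs _ Qs.
have [t Qxt] := Qs x (mem_head x s).
have [s0|s_neq0] := eqVneq s [::].
  exists x, t; split; rewrite ?mem_head // s0 => y t' /[1!inE] /eqP->.
  by move=> /(Qfun _ _ _ Qxt)->.
have [|y [u [ys Qyu u_min]]] := IHs s_neq0.
  by move=> y ys; apply: Qs; rewrite inE ys orbT.
have [le_tu|lt_ut] := lerP t u.
  exists x, t; split; rewrite ?mem_head // => z t' /[1!inE] /orP[/eqP->|zs Qz].
    by move=> /(Qfun _ _ _ Qxt)->.
  exact: le_trans le_tu (u_min z t' zs Qz).
exists y, u; split; rewrite ?inE ?ys ?orbT // => z t' /[1!inE] /orP[/eqP->|zs Qz].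
  by move=> /(Qfun _ _ _ Qxt)<-; apply: ltW.
exact: u_min zs Qz.
Qed.

Lemma tour_catC d p q : tour d (p ++ q) = tour d (q ++ p).
Proof.
case: p q => [|x p] [|y q]; rewrite ?cats0 // !cat_cons !tour_cons.
rewrite !rcons_cat !rcons_cons !walk_length_cat /= !walk_length_rcons; lra.
Qed.

Lemma tour_split d x p q :
  tour d (x :: p ++ x :: q) = tour d (x :: p) + tour d (x :: q).
Proof. by rewrite !tour_cons rcons_cat rcons_cons -cat_rcons walk_length_cat last_rcons. Qed.

Lemma circuit_split eo x p q :
  circuit eo (x :: p ++ x :: q) = circuit eo (x :: p) && circuit eo (x :: q).
Proof.
by rewrite /circuit /= rcons_cat rcons_cons -cat_rcons cat_path last_rcons.
Qed.

Lemma not_uniq_split c : ~~ uniq c ->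
  exists s x p q, c = s ++ x :: p ++ x :: q.
Proof.
elim: c => //= y c IHc; rewrite negb_and negbK => /orP[yc|/IHc].
  by case/splitPr: yc => p q; exists [::], y, p, q.
by case=> [s [x [p [q ->]]]]; exists (y :: s), x, p, q.
Qed.

(** A circuit that repeats a vertex splits there into two shorter circuits, and the bounds add up;
    one without repetition has at most [#|V|] arcs. *)
Lemma tour_le_small_circuits d (eo : rel V) (t : R) :
  (forall c, circuit eo c -> (size c <= #|V|)%N -> tour d c <= t * (size c)%:R) ->
  forall c, circuit eo c -> tour d c <= t * (size c)%:R.
Proof.
move=> small c; elim: {c}(size c).+1 {-2}c (ltnSn (size c)) => // n IHn c.
rewrite ltnS => le_cn cyc.
have [/card_uniqP card_c|/not_uniq_split] := boolP (uniq c).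
  by apply: small; rewrite // -card_c max_card.
case=> [s [x [p [q def_c]]]].
(* The circuit is rotated to start at its repeated vertex. *)
have def_rot : x :: p ++ x :: (q ++ s) = rot (size s) c.
  by rewrite def_c rot_size_cat /= -catA.
have -> : tour d c = tour d (x :: p ++ x :: (q ++ s)).
  by rewrite def_c tour_catC /= -catA.
have : circuit eo (x :: p ++ x :: (q ++ s)).
  rewrite def_rot /circuit rot_cycle; case/andP: cyc => _ ->; rewrite andbT.
  by rewrite -size_eq0 size_rot def_c size_cat addnS.
rewrite circuit_split => /andP[cyc1 cyc2].
have szc : size c = (size (x :: p) + size (x :: (q ++ s)))%N.
  by rewrite -size_cat -(size_rot (size s)) -def_rot.
rewrite tour_split szc natrD mulrDr lerD // IHn // (leq_trans _ le_cn) // szc.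
  by rewrite -addn1 leq_add2l.
by rewrite -add1n leq_add2r.
Qed.

Variable G : network R V.
Hypothesis V_gt1 : (1 < #|V|)%N.

(** The maximum over the finitely many circuits of at most [#|V|] arcs bounds all the others. *)
Lemma cycle_time_exists eo : overlay G eo -> exists t, is_cycle_time G eo t.
Proof.
move=> Oeo.
pose s := [seq c <- [seq val b | b <- enum {: #|V|.-bseq V}] | circuit eo c].
have s_mem c : (c \in s) = circuit eo c && (size c <= #|V|)%N.
  rewrite mem_filter; congr (_ && _); apply/mapP/idP => [[b _ ->]|le_c].
    exact: size_bseq.
  by exists (Bseq le_c); rewrite ?mem_enum.
have s_neq0 : s != [::].
  have /card_gt0P[i _] : (0 < #|V|)%N by apply: ltnW.
  have [j _ ij] := overlay_succ Oeo V_gt1 i.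
  case: (Oeo) => _ /(_ j i)/connectP[p0 /shortenP[p jp Up _] p_last].
  suff: (j :: p) \in s by case: s {s_mem}.
  by rewrite s_mem -(card_uniqP Up) max_card andbT /circuit /= rcons_path jp -p_last.
(* Negating the means turns the minimum into a maximum. *)
have [||c [t [cs ->{t} c_max]]] :=
  @seq_min_value _ (fun c t => t = - circuit_mean G eo c) s s_neq0.
- by move=> c _; eexists.
- by move=> c t t' -> ->.
move: cs; rewrite s_mem => /andP[cyc le_c].
exists (circuit_mean G eo c); split; first by exists c.
have pos c' : circuit eo c' -> 0 < (size c')%:R :> R.
  by rewrite ltr0n lt0n size_eq0 => /andP[].
move=> c' cyc'; rewrite [leLHS]/circuit_mean ler_pdivrMr ?pos //.
apply: (tour_le_small_circuits (d := overlay_delay G eo)) cyc' => c1 cyc1 le_c1.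
rewrite -ler_pdivrMr ?pos // -lerN2.
by apply: (c_max c1); rewrite // s_mem cyc1.
Qed.

Lemma is_cycle_time_uniq eo t t' :
  is_cycle_time G eo t -> is_cycle_time G eo t' -> t = t'.
Proof.
case=> [[c cyc <-] c_max] [[c' cyc' <-] c'_max].
by apply: le_anti; rewrite c'_max // c_max.
Qed.

Lemma circuit_delay_eq eo eo' c : eo =2 eo' ->
  circuit_delay G eo c = circuit_delay G eo' c.
Proof.
move=> e_eq; apply: eq_bigr => a _; rewrite /overlay_delay.
have -> : outdeg eo a.1 = outdeg eo' a.1 by apply: eq_card => j; rewrite !inE e_eq.
by have -> : indeg eo a.2 = indeg eo' a.2 by apply: eq_card => i; rewrite !inE e_eq.
Qed.

Lemma is_cycle_time_eq eo eo' t : eo =2 eo' ->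
  is_cycle_time G eo t -> is_cycle_time G eo' t.
Proof.
move=> e_eq [[c cyc <-] c_max].
have circuitE c1 : circuit eo' c1 = circuit eo c1.
  by rewrite /circuit (eq_cycle e_eq).
have meanE c1 : circuit_mean G eo' c1 = circuit_mean G eo c1.
  by rewrite /circuit_mean (circuit_delay_eq c1 e_eq).
split; first by exists c; rewrite ?circuitE ?meanE.
by move=> c1; rewrite circuitE meanE; apply: c_max.
Qed.

Lemma overlay_eq eo eo' : eo =2 eo' -> overlay G eo -> overlay G eo'.
Proof.
move=> e_eq [sub_eo con_eo]; split=> [i j|i j].
  by rewrite -e_eq; apply: sub_eo.
by rewrite -(eq_connect e_eq).
Qed.

(** Relations are coded by sets of arcs to obtain a finite search space. Decoding returns only a
    pointwise equal relation, hence the transport along [=2]. *)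
Lemma min_cycle_time_exists eo : overlay G eo -> exists t, is_min_cycle_time G t.
Proof.
move=> Oeo; pose rel_of (E : {set V * V}) : rel V := [rel i j | (i, j) \in E].
pose set_of (e : rel V) : {set V * V} := [set a | e a.1 a.2].
have set_ofK e : e =2 rel_of (set_of e) by move=> i j; rewrite /rel_of /= inE.
pose overlayb E := [forall i, forall j,
  (rel_of E i j ==> link G i j) && connect (rel_of E) i j].
have overlayP E : reflect (overlay G (rel_of E)) (overlayb E).
  apply: (iffP forallP) => [ovE | [subE conE] i].
    split=> i j; have /forallP/(_ j)/andP[+ con] := ovE i; last by [].
    by move/implyP.
  by apply/forallP=> j; rewrite conE andbT; apply/implyP; apply: subE.
have [|||E [t [E_in Et E_min]]] :=
    @seq_min_value _ (fun E => is_cycle_time G (rel_of E)) (enum [set E | overlayb E]).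
- apply/negP => /eqP enum0; have: set_of eo \in enum [set E | overlayb E].
    by rewrite mem_enum inE; apply/overlayP; apply: overlay_eq Oeo.
  by rewrite enum0.
- by move=> E; rewrite mem_enum inE => /overlayP; apply: cycle_time_exists.
- by move=> E t t'; apply: is_cycle_time_uniq.
exists t; split.
  by exists (rel_of E) => //; apply/overlayP; rewrite mem_enum inE in E_in.
move=> eo' t' Oeo' t'P; apply: (E_min (set_of eo')).
  by rewrite mem_enum inE; apply/overlayP; apply: overlay_eq Oeo'.
exact: is_cycle_time_eq t'P.
Qed.

End CycleTimeExists.

(** * Cycle time of a directed ring *)

Section DirectedRing.
Variables (R : realFieldType) (V : finType) (G : network R V) (h : seq V).
Hypothesis V_gt1 : (1 < #|V|)%N.
Hypothesis complete : forall i j, i != j -> link G i j.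
Hypothesis h_ham : hamiltonian h.

Let Uh : uniq h. Proof. by case: h_ham. Qed.
Let h_all i : i \in h. Proof. by case: h_ham. Qed.
Let size_h : size h = #|V|.
Proof. by rewrite -(card_uniqP Uh); apply: eq_card => i; rewrite h_all inE. Qed.
Let ringE i j : directed_ring h i j = (next h i == j).
Proof. by rewrite /directed_ring /= h_all. Qed.

Lemma link_next i : link G i (next h i).
Proof. by rewrite complete // eq_sym next_neq // size_h. Qed.

Lemma directed_ring_overlay : overlay G (directed_ring h).
Proof.
split=> i j; first by rewrite ringE => /eqP <-; apply: link_next.
rewrite (eq_connect (e' := frel (next h))) => [|x y]; last by rewrite ringE.
by rewrite (fconnect_cycle (cycle_next Uh)).
Qed.

Lemma overlay_delay_ring i :
  overlay_delay G (directed_ring h) i (next h i) = ring_delay G i (next h i).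
Proof.
rewrite /overlay_delay; have -> : outdeg (directed_ring h) i = 1%N.
  rewrite /outdeg -(cards1 (next h i)); apply: eq_card => j.
  by rewrite !inE ringE eq_sym.
have -> : indeg (directed_ring h) (next h i) = 1%N.
  rewrite /indeg -(cards1 i); apply: eq_card => j.
  by rewrite !inE ringE (inj_eq (can_inj (prev_next Uh))).
by rewrite !divr1.
Qed.

Lemma sum_count (F : V -> R) (c : seq V) :
  \sum_(x <- c) F x = \sum_x F x * (count_mem x c)%:R.
Proof.
elim: c => [|y c IHc].
  by rewrite big_nil big1 // => x _; rewrite mulr0.
rewrite big_cons IHc [in RHS](eq_bigr (fun x => F x * (y == x)%:R + F x * (count_mem x c)%:R)).
  rewrite big_split /=; congr (_ + _).
  rewrite (bigD1 y) //= eqxx mulr1 big1 ?addr0 // => x.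
  by rewrite eq_sym => /negPf->; rewrite mulr0.
by move=> x _; rewrite /= natrD mulrDr.
Qed.

Lemma map_fcycle (f : V -> V) (c : seq V) : fcycle f c -> map f c = rot 1 c.
Proof.
case: c => // x p; rewrite rot1_cons /=; move: {2 4}x => y.
by elim: p x => [|z p IHp] x /= /andP[/eqP-> // /IHp->].
Qed.

(** A circuit of the ring must follow [next], so its image under [next] is a rotation of itself; a
    vertex and its successor thus occur equally often. *)
Lemma ring_circuit_count c x y : circuit (directed_ring h) c ->
  count_mem x c = count_mem y c.
Proof.
case/andP=> _ cyc; have {cyc} fc : fcycle (next h) c.
  by rewrite -(eq_cycle ringE).
have count_next z : count_mem (next h z) c = count_mem z c.
  have -> : count_mem (next h z) c = count_mem (next h z) (rot 1 c).
    by apply/esym/permP; rewrite perm_rot.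
  rewrite -(map_fcycle fc) count_map; apply: eq_count => i /=.
  by rewrite (inj_eq (can_inj (prev_next Uh))).
have: fconnect (next h) y x by rewrite (fconnect_cycle (cycle_next Uh)).
move/iter_findex<-; elim: (findex _ _ _) => //= n IHn.
by rewrite count_next.
Qed.

(** All vertices occur equally often in a circuit of the ring, so all circuits have the same
    mean. *)
Lemma ring_cycle_time : is_cycle_time G (directed_ring h)
  ((\sum_(x <- h) ring_delay G x (next h x)) / #|V|%:R).
Proof.
have delayE c : circuit (directed_ring h) c ->
    circuit_delay G (directed_ring h) c = \sum_(x <- c) ring_delay G x (next h x).
  case/andP=> _ cyc; have fc : fcycle (next h) c by rewrite -(eq_cycle ringE).
  rewrite /circuit_delay -(map_fcycle fc) -{1}(map_id c) zip_map big_map.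
  by apply: eq_bigr => x _; rewrite overlay_delay_ring.
have meanE c : circuit (directed_ring h) c ->
    circuit_mean G (directed_ring h) c
      = (\sum_x ring_delay G x (next h x)) / #|V|%:R.
  move=> cyc; have [x0 x0c] : exists x0, x0 \in c.
    by case: c cyc => // x0 c _; exists x0; rewrite mem_head.
  rewrite /circuit_mean delayE // sum_count.
  have -> : (size c)%:R = #|V|%:R * (count_mem x0 c)%:R :> R.
    rewrite -sum1_size natr_sum sum_count.
    rewrite (eq_bigr (fun=> (count_mem x0 c)%:R)) => [|x _].
      by rewrite sumr_const mulr_natl.
    by rewrite mul1r (ring_circuit_count x x0 cyc).
  rewrite (eq_bigr (fun x => ring_delay G x (next h x) * (count_mem x0 c)%:R)) => [|x _].
    rewrite -mulr_suml -mulf_div divff ?mulr1 // pnatr_eq0 -lt0n.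
    by rewrite -has_count has_pred1.
  by rewrite (ring_circuit_count x x0 cyc).
have cyc_h : circuit (directed_ring h) h.
  rewrite /circuit -size_eq0 size_h -lt0n (ltnW V_gt1) /=.
  by rewrite (eq_cycle ringE) cycle_next.
have <- : circuit_mean G (directed_ring h) h
    = (\sum_(x <- h) ring_delay G x (next h x)) / #|V|%:R.
  by rewrite /circuit_mean delayE // size_h.
by split=> [|c cyc]; [exists h | rewrite !meanE].
Qed.

End DirectedRing.

(** * The approximation bound *)

Lemma sum_const_seq (R : realFieldType) (T : Type) (s : seq T) (x : R) :
  \sum_(i <- s) x = x * (size s)%:R.
Proof. by rewrite big_const_seq count_predT iter_addr_0 mulr_natr. Qed.

Section Approximation.
Variables (R : realFieldType) (V : finType) (G : network R V).
Variables (w : {set V} -> R) (h : seq V).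
Hypothesis V_gt1 : (1 < #|V|)%N.
Hypothesis G_euclidean : euclidean G.
Hypothesis w_ring : edge_weights_of (link G) w (ring_delay G).

Let complete i j : i != j -> link G i j.
Proof. by case: G_euclidean => cG _ _; apply: cG. Qed.

Let core_sym i j : link G i j -> core_delay G i j = core_delay G j i.
Proof. by case: G_euclidean => _ sG _; apply: sG. Qed.

(** The diagonal is set to zero because [core_delay] is meaningless on loops. *)
Definition core_dist i j : R := if i == j then 0 else core_delay G i j.

Lemma core_dist_self i : core_dist i i = 0.
Proof. by rewrite /core_dist eqxx. Qed.

Lemma core_dist_ge0 i j : 0 <= core_dist i j.
Proof.
by rewrite /core_dist; case: eqP => // /eqP nij; rewrite core_delay_ge0 ?complete.
Qed.

Lemma core_dist_sym i j : core_dist i j = core_dist j i.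
Proof.
rewrite /core_dist eq_sym; case: eqP => // /eqP nij.
by rewrite core_sym // complete // eq_sym.
Qed.

Lemma core_dist_triangle i j k : core_dist i j <= core_dist i k + core_dist k j.
Proof.
have [->|nik] := eqVneq i k; first by rewrite core_dist_self add0r.
have [->|nkj] := eqVneq k j; first by rewrite core_dist_self addr0.
have [->|nij] := eqVneq i j.
  by rewrite core_dist_self addr_ge0 ?core_dist_ge0.
rewrite /core_dist (negPf nik) (negPf nkj) (negPf nij).
by case: G_euclidean => _ _ tG; apply: tG; apply: complete.
Qed.

(** The weight lies between the ring delays of the two orientations, both at least the common core
    delay. *)
Lemma core_dist_le_weight i j : [set i; j] \in edges (link G) ->
  core_dist i j <= w [set i; j].
Proof.
case/imsetP => [[a b]]; rewrite inE /= => Lab eij.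
have nij : i != j.
  apply: contraTneq Lab => ij; move: eij; rewrite ij setUid => ejab.
  have /set1P-> : a \in [set j] by rewrite ejab set21.
  have /set1P-> : b \in [set j] by rewrite ejab set22.
  by rewrite link_irr.
have Lij := complete nij; have Lji : link G j i by rewrite complete // eq_sym.
have /andP[le_w _] := w_ring Lij; apply: le_trans le_w.
rewrite /core_dist (negPf nij) le_min core_delay_le_ring //.
by rewrite core_sym // core_delay_le_ring.
Qed.

(** * Comparison with an overlay of bounded circuit means *)

Section OptimalOverlay.
Variables (eo : rel V) (t : R).
Hypothesis eo_overlay : overlay G eo.
Hypothesis mean_le : forall c, circuit eo c -> circuit_mean G eo c <= t.

Let K : R := #|V|%:R * t.

Let up_le := up_le_cycle eo_overlay V_gt1 mean_le.
Let dn_le := dn_le_cycle eo_overlay V_gt1 mean_le.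

Lemma weight_le_core_dist i j : i != j -> w [set i; j] <= core_dist i j + K.
Proof.
move=> nij; have Lij := complete nij.
have Lji : link G j i by rewrite complete // eq_sym.
have /andP[_ w_le] := w_ring Lij; apply: le_trans w_le _.
rewrite /core_dist (negPf nij) ge_max ring_delay_le_core //.
by rewrite core_sym // ring_delay_le_core.
Qed.

(** The weight may reflect the reverse orientation, possibly no arc of the overlay, so both ring
    delays have to be bounded. *)
Lemma weight_le_overlay i j : eo i j -> w [set i; j] <= K.
Proof.
move=> ij; have Lij : link G i j by case: eo_overlay => sub_eo _; apply: sub_eo.
have Lji : link G j i.
  by rewrite complete //; apply: contraTneq Lij => ->; rewrite link_irr.
have /andP[_ w_le] := w_ring Lij; apply: le_trans w_le _.
rewrite ge_max; apply/andP; split; last first.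
  exact (reverse_ring_delay_le eo_overlay mean_le Lji (core_sym Lji) ij).
apply: le_trans (ring_delay_le_overlay eo_overlay ij) _.
exact (overlay_delay_le eo_overlay mean_le ij).
Qed.

Let g := cheap G eo t.

Lemma cheap_weight i j : g i j -> w [set i; j] <= K.
Proof.
by case/orP=> /andP[/weight_le_overlay]; rewrite 1?setUC.
Qed.

Lemma overlay_neq i j : eo i j -> i != j.
Proof.
case: eo_overlay => sub_eo _ /sub_eo; apply: contraTneq => ->.
by rewrite link_irr.
Qed.

(** The core distance ignores orientation, so it keeps the bound [K / 2] where the weight only gets
    [K]. *)
Lemma cheap_core_dist i j : g i j -> core_dist i j <= K / 2.
Proof.
suff le_half a b : eo a b -> overlay_delay G eo a b <= K / 2 -> core_dist a b <= K / 2.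
  case/orP=> /andP[/le_half le_ab /le_ab //].
  by rewrite core_dist_sym.
move=> ab; apply: le_trans; rewrite /core_dist (negPf (overlay_neq ab)).
apply: le_trans (ring_delay_le_overlay eo_overlay ab).
by rewrite core_delay_le_ring ?complete ?overlay_neq.
Qed.

Lemma cheap_link : subrel g (link G).
Proof.
by move=> i j /orP[]/andP[/overlay_neq nij _]; rewrite complete // eq_sym.
Qed.

Let crossing := cheap_crossing eo_overlay mean_le.

Lemma cycle_bound_ge0 : 0 <= K.
Proof.
have /card_gt0P[i _] : (0 < #|V|)%N by apply: ltnW.
apply: le_trans (up_le i); exact: div_model_size_ge0 (uplink_gt0 G i).
Qed.

Let size_V : (#|V|.-1)%:R = #|V|%:R - 1 :> R.
Proof. by rewrite -subn1 natrB // ltnW. Qed.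

Lemma min_spanning_tree_weight_le T : min_spanning_tree (link G) w T ->
  weight w T <= (#|V|%:R - 1) * K.
Proof.
case=> _ T_min; have /card_gt0P[r _] : (0 < #|V|)%N by apply: ltnW.
have [F [treeF cardF gF]] := spanning_tree_in crossing r cheap_link.
apply: le_trans (T_min F treeF) _.
have : weight w F <= K *+ #|F|.
  rewrite -sumr_const; apply: ler_sum => a /gF[x [y [gxy ->]]].
  exact: cheap_weight.
move=> /le_trans; apply; rewrite -[K *+ _]mulr_natl ler_wpM2r ?cycle_bound_ge0 //.
by rewrite -size_V ler_nat -ltnS prednK // ltnW.
Qed.

Lemma min_perfect_matching_weight_le (S : {set V}) Mt :
  min_perfect_matching (link G) w S Mt ->
  2 * weight w Mt <= (2 * #|V|%:R - 1) * K.
Proof.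
case=> [[Mt_edges part_Mt] Mt_min].
have /card_gt0P[r _] : (0 < #|V|)%N by apply: ltnW.
have [p [gp p_last szp p_all]] := closed_spanning_walk (cheap_sym _ _ _) crossing r.
(* The vertices of [S], listed as a subsequence of the closed walk. *)
pose s := [seq x <- undup (r :: p) | x \in S].
have Us : uniq s by rewrite filter_uniq // undup_uniq.
have Ss : [set x in s] = S.
  by apply/setP => x; rewrite inE mem_filter mem_undup p_all andbT.
(* Parity comes from the matching itself, whose two-element blocks partition [S]. *)
have even_s : ~~ odd (size s).
  have -> : size s = #|S| by rewrite -(card_uniqP Us) -Ss cardsE.
  rewrite (card_uniform_partition (n := 2) _ part_Mt) ?oddM ?andbF //.
  move=> a /(subsetP Mt_edges)/imsetP[[x y]]; rewrite inE /= => Lxy ->.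
  by rewrite cards2; case: eqP Lxy => // ->; rewrite link_irr.
have pairs_le s' : uniq s' -> ~~ odd (size s') -> [set x in s'] = S ->
    weight w Mt <= \sum_(a <- pairs s') w a.
  move=> Us' even_s' Ss'.
  have [Up part] := pairs_partition Us' even_s'.
  rewrite (big_uniq _ Up) /=.
  have -> : \sum_(a in pairs s') w a = weight w [set a in pairs s'].
    by apply: eq_bigl => a; rewrite inE.
  apply: Mt_min; split; last by rewrite -Ss'.
  apply/subsetP => a; rewrite inE => /(pairsP Us')[x [y [nxy ->]]].
  by apply/imsetP; exists (x, y); rewrite ?inE ?complete.
have le1 := pairs_le s Us even_s Ss.
have le2 : weight w Mt <= \sum_(a <- pairs (rot 1 s)) w a.
  apply: pairs_le; rewrite ?rot_uniq ?size_rot //.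
  by rewrite -Ss; apply/setP => x; rewrite !inE mem_rot.
(* At most [2 * (#|V| - 1)] arcs, each of core length at most [K / 2]. *)
have walk_le : walk_length core_dist r p <= K * (#|V|%:R - 1).
  apply: le_trans (walk_length_le cheap_core_dist gp) _.
  rewrite -mulrA ler_wpM2l ?cycle_bound_ge0 // ler_pdivrMl //.
  have : (size p + 2)%:R <= (2 * #|V|)%:R :> R by rewrite ler_nat.
  rewrite natrD natrM; lra.
have tour_le : tour core_dist s <= walk_length core_dist r p.
  apply: le_trans (tour_subseq core_dist_self core_dist_triangle
    (subseq_trans (filter_subseq _ _) (undup_subseq _))) _.
  by rewrite tour_cons walk_length_rcons p_last core_dist_self addr0.
have edges_le : \sum_(a <- walk_edges s) w a <= tour core_dist s + K * (size s)%:R.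
  rewrite /walk_edges zip_next // !big_map tour_next //=.
  rewrite -sum_const_seq -big_split /=.
  rewrite big_seq [leRHS]big_seq; apply: ler_sum => x xs.
  rewrite weight_le_core_dist // eq_sym next_neq //.
  (* Even parity excludes size one, where [next] would fix [x]. *)
  by case: (s) xs even_s => [|? []].
have size_s : K * (size s)%:R <= K * #|V|%:R.
  by rewrite ler_wpM2l ?cycle_bound_ge0 // ler_nat -(card_uniqP Us) max_card.
(* Each alternate matching weighs at least [weight w Mt], and together they weigh the whole tour, at
   most [(#|V| - 1) * K + #|V| * K]. *)
have := sum_pairs_rot w even_s; lra.
Qed.

Lemma christofides_ring_delay_le : christofides (link G) w h ->
  \sum_(x <- h) ring_delay G x (next h x) <= 3 * #|V|%:R * K.
Proof.
case=> T [Mt [c [minT minMt euler [ham sub_hc]]]].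
have [Uh h_all] := ham.
have size_h : size h = #|V|.
  by rewrite -(card_uniqP Uh); apply: eq_card => i; rewrite h_all inE.
have T_le := min_spanning_tree_weight_le minT.
have Mt_le := min_perfect_matching_weight_le minMt.
have ring_le : \sum_(x <- h) ring_delay G x (next h x)
    <= tour core_dist h + K * (size h)%:R.
  rewrite tour_next // -sum_const_seq -big_split /=.
  apply: ler_sum => x _; have nx : x != next h x.
    by rewrite eq_sym next_neq ?size_h.
  by rewrite /core_dist (negPf nx) ring_delay_le_core ?complete.
have tour_le := tour_subseq core_dist_self core_dist_triangle sub_hc.
have walk_le : tour core_dist c <= weight w T + weight w Mt.
  (* The Eulerian circuit traverses each edge with its multiplicity in [T + Mt]. *)
  have -> : weight w T + weight w Mt = \sum_(a <- walk_edges c) w a.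
    by rewrite (perm_big _ euler) /= big_cat !big_enum.
  rewrite /walk_edges big_map /tour big_seq [leRHS]big_seq.
  apply: ler_sum => a ac; apply: core_dist_le_weight.
  have : [set a.1; a.2] \in walk_edges c by apply: map_f.
  rewrite (perm_mem euler) mem_cat !mem_enum.
  case: minT minMt => [[/subsetP subT _ _] _] [[/subsetP subMt _] _].
  by case/orP=> [/subT|/subMt].
(* The sum of the bounds is [(3 * #|V| - 3 / 2) * K], and [K] is nonnegative. *)
have := cycle_bound_ge0; rewrite size_h in ring_le; lra.
Qed.

End OptimalOverlay.
End Approximation.

Theorem proposition3p6 (R : realFieldType) (V : finType) (G : network R V)
    (w : {set V} -> R) (h : seq V)
    (hN : (1 < #|V|)%N)
    (hG : euclidean G)
    (hw : edge_weights_of (link G) w (ring_delay G))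
    (hh : christofides (link G) w h) :
  overlay G (directed_ring h) /\
  exists tauC tauStar : R,
    [/\ is_cycle_time G (directed_ring h) tauC,
        is_min_cycle_time G tauStar
      & tauC <= 3 * #|V|%:R * tauStar].
Proof.
have [complete _ _] := hG.
have ham : hamiltonian h by case: hh => T [Mt [c [_ _ _ []]]].
have ring_ov := directed_ring_overlay hN complete ham.
split=> //; have [t min_t] := min_cycle_time_exists hN ring_ov.
exists ((\sum_(x <- h) ring_delay G x (next h x)) / #|V|%:R), t.
split=> //; first exact: ring_cycle_time.
case: min_t => [[eo eo_ov [_ mean_le]] _].
(* As [K] is [#|V| * t], the total ring delay is at most [3 * #|V| * (#|V| * t)]; the mean divides
   it by [#|V|]. *)
rewrite ler_pdivrMr ?ltr0n ?(ltnW hN) //.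
have := christofides_ring_delay_le hN hG hw eo_ov mean_le hh; lra.
Qed.
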